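(* Let $q=p^{2r+1}$, where $p$ is a prime and $r$ is a non-negative integer. If $A \subseteq \mathbb{F}_q$ is such that $2p^r<|A|<\sqrt{q}$, then $$\left|\frac{A-A}{A-A}\right| >\frac{|A|^2}{2}.$$
   Context: $\mathbb{F}_q$ is the finite field with $q$ elements. For sets $A,B\subseteq\mathbb{F}_q$, $A-B=\{a-b: a\in A, b\in B\}$ and $\frac{A}{B}=A/B=\{a/b: a\in A, b\in B\}\subseteq \mathbb{F}_q\cup\{\infty\}$, where $a/0$ is defined to be $\infty$ for each $a\in\mathbb{F}_q$. *)

(* Defs.v *)
From HB Require Import structures.
From mathcomp Require Import all_boot all_order all_algebra all_field.

Set Implicit Arguments.
Unset Strict Implicit.
Unset Printing Implicit Defensive.

Import Order.TTheory GRing.Theory Num.Theory.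
Local Open Scope ring_scope.

Definition diffset (F : finFieldType) (A B : {set F}) : {set F} :=
  [set a - b | a in A, b in B].

(* F together with infinity is [option F], infinity being [None]; note that    *)
(* 0 / 0 is infinity as well.                                                  *)
Definition quot (F : finFieldType) (a b : F) : option F :=
  if b == 0 then None else Some (a / b).

Definition quotset (F : finFieldType) (A B : {set F}) : {set option F} :=
  [set quot a b | a in A, b in B].

(* Main.v *)
Require Import Defs.
From HB Require Import structures.
From mathcomp Require Import all_boot all_order all_algebra all_field.
From mathcomp Require Import zify ring.

(* Redei's polynomial method for the point set A x A, in the lacunary form of
   Szonyi. Put n = |A|^2, D = (A - A)/(A - A) and
   H(X, Y) = \prod_(a, b in A) (X - (b - a Y)), and let
   S(X, Y) = \sum_k r_k(Y) X^k be the remainder of X^q modulo H, where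
   deg r_k <= q - k. If y is not in D, then the n < q values b - a y are
   distinct, so H(X, y) divides X^q - X and S(X, y) = X. Having more roots than
   its degree, r_k vanishes for k >= |D|. At y = 0 every b in A is thus a root
   of multiplicity at least |A| of X^q - g, where deg g < |D|.
   Write X^q - g = Q(X^s) with s = p^e and Q' <> 0. Counting the roots of Q
   gives s <= p^r, and counting those of Q' with multiplicity gives
   |A| (|A| - s) < |D|, where s <= p^r < |A| / 2. *)

Set Implicit Arguments.
Unset Strict Implicit.
Unset Printing Implicit Defensive.

Import Order.TTheory GRing.Theory Num.Theory.
Local Open Scope ring_scope.

(** * Bivariate division with control of the total degree *)

(* Total degree at most d in the two variables, the outer one being X. *)
Definition wdeg (R : comNzRingType) (d : nat) (P : {poly {poly R}}) :=
  forall k, (size (P`_k)%R <= d.+1 - k)%N.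

Lemma wdeg_mul (R : comNzRingType) d e (P Q : {poly {poly R}}) :
  wdeg d P -> wdeg e Q -> wdeg (d + e) (P * Q).
Proof.
move=> hP hQ k; rewrite coefM; apply: leq_trans (size_sum _ _ _) _.
apply/bigmax_leqP => -[i /= hi] _.
(* Zero factors are treated apart: only nonzero ones force [i <= d] and [k - i <= e], without which
   truncated subtraction breaks the bound. *)
have [->|Pi] := eqVneq P`_i 0; first by rewrite mul0r size_poly0.
have [->|Qi] := eqVneq Q`_(k - i) 0; first by rewrite mulr0 size_poly0.
apply: leq_trans (size_polyMleq _ _) _.
rewrite -size_poly_gt0 in Pi; rewrite -size_poly_gt0 in Qi.
have arith a b : (0 < a -> 0 < b -> a <= d.+1 - i -> b <= e.+1 - (k - i) ->
  (a + b).-1 <= (d + e).+1 - k)%N by lia.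
exact: arith Pi Qi (hP i) (hQ _).
Qed.

Lemma wdeg_prod (R : comNzRingType) (I : finType) (E : {set I})
    (G : I -> {poly {poly R}}) :
  (forall i, wdeg 1 (G i)) -> wdeg #|E| (\prod_(i in E) G i).
Proof.
move=> hG; rewrite -sum1_card; elim/big_ind2: _ => // [k|P d Q e].
  by rewrite coefC; case: k => [|k]; rewrite ?size_poly1 ?size_poly0.
exact: wdeg_mul.
Qed.

(** Long division, one power of X at a time: multiplying [S] by X may create a term in X^n, and
    subtracting [c * H] cancels it. Since [c] has degree at most m + 1 - n in Y, the total degree
    stays at most m + 1. *)
Lemma monic_divXn_wdeg (R : comNzRingType) n (H : {poly {poly R}}) m :
    (0 < n)%N -> H \is monic -> size H = n.+1 -> wdeg n H ->
  exists Q S : {poly {poly R}},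
    [/\ 'X^m = Q * H + S, (size S <= n)%N & wdeg m S].
Proof.
move=> n_gt0 H_monic szH wH; elim: m => [|m [Q [S [eqX szS wS]]]].
  exists 0, 1; rewrite mul0r add0r expr0 size_poly1; split=> // k.
  by rewrite coefC; case: k => [|k]; rewrite ?size_poly1 ?size_poly0.
pose c := S`_n.-1; exists (Q * 'X + c%:P), (S * 'X - c%:P * H); split.
- by rewrite exprSr eqX; ring.
- apply/leq_sizeP => -[|j] hj; first by rewrite leqNgt n_gt0 in hj.
  rewrite coefB coefMX coefCM /=; have [nj|nj] := eqVneq n j.+1.
    move/monicP: H_monic; rewrite lead_coefE szH /= => Hn.
    by rewrite -nj Hn mulr1 /c nj subrr.
  have le_nj : (n <= j)%N by rewrite -ltnS ltn_neqAle nj.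
  by rewrite !nth_default ?mulr0 ?subr0 ?szH ?(leq_trans szS).
move=> k; rewrite coefB; apply: leq_trans (size_polyD _ _) _.
rewrite geq_max size_polyN; apply/andP; split.
  by rewrite coefMX; case: k => [|k] /=; rewrite ?size_poly0 // subSS.
(* A nonzero [c] forces n <= m + 1, so m + 1 - n is a true difference. *)
have [->|c_neq0] := eqVneq c 0; first by rewrite mul0r coef0 size_poly0.
have le_n : (n <= m.+1)%N.
  rewrite -size_poly_gt0 in c_neq0.
  by have := leq_trans c_neq0 (wS _); lia.
rewrite -{1}(subnK le_n); apply: (wdeg_mul _ wH) => {}k; rewrite coefC.
case: eqP => [->|_]; last by rewrite size_poly0.
by apply: leq_trans (wS _) _; lia.
Qed.

(** * Root multiplicities and Frobenius powers *)

Lemma dvdp_prod_XsubC_exp (F : fieldType) (I : finType) (E : {set I})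
    (f : I -> F) m (Q : {poly F}) :
    {in E &, injective f} -> (forall i, i \in E -> ('X - (f i)%:P) ^+ m %| Q) ->
  \prod_(i in E) ('X - (f i)%:P) ^+ m %| Q.
Proof.
move=> f_inj hQ; rewrite -big_enum.
have : {subset enum E <= E} by move=> i; rewrite mem_enum.
elim: (enum E) (enum_uniq E) => [|i s IH]; first by rewrite big_nil dvd1p.
move=> /= /andP[is_ us] sub; rewrite big_cons Gauss_dvdp.
  rewrite hQ ?sub ?mem_head //=; apply: IH => // j js.
  by rewrite sub // inE js orbT.
rewrite big_seq; elim/big_rec: _ => [|j G js IHG]; first exact: coprimep1.
rewrite coprimepMr IHG andbT coprimep_expl // coprimep_expr // coprimep_XsubC.
rewrite root_XsubC; apply: contra is_ => /eqP /f_inj <-//.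
  by rewrite sub // inE js orbT.
by rewrite sub // mem_head.
Qed.

Lemma card_exp_XsubC_lt_size (F : fieldType) (I : finType) (E : {set I})
    (f : I -> F) m (Q : {poly F}) :
    {in E &, injective f} -> (forall i, i \in E -> ('X - (f i)%:P) ^+ m %| Q) ->
  Q != 0 -> (#|E| * m < size Q)%N.
Proof.
move=> f_inj hQ Q0; have := dvdp_leq Q0 (dvdp_prod_XsubC_exp f_inj hQ).
rewrite size_prod => [|i _]; last by rewrite expf_neq0 // polyXsubC_eq0.
rewrite (eq_bigr (fun=> m.+1)) => [|i _]; last by rewrite size_exp_XsubC.
by rewrite sum_nat_const mulnS -addnS addKn.
Qed.

Lemma dvdp_exp_XsubC_deriv (F : fieldType) (x : F) m (Q : {poly F}) :
  ('X - x%:P) ^+ m.+1 %| Q -> ('X - x%:P) ^+ m %| Q^`().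
Proof.
case/dvdpP => q ->; rewrite derivM deriv_exp derivXsubC mul1r exprS.
apply: dvdp_add; first by rewrite !dvdp_mull.
by rewrite mulrnAr -mulrnAl dvdp_mull.
Qed.

(** With s = p^e, Frobenius gives X^s - b^s = (X - b)^s, so a root b^s of multiplicity k in Q
    becomes a root b of multiplicity exactly s k in Q(X^s). From m s < n <= s k follows m < k. *)
Lemma dvdp_exp_XsubC_comp_pchar (F : fieldType) p e (b : F) m n (Q : {poly F}) :
    p \in [pchar F] -> ('X - b%:P) ^+ n %| Q \Po 'X^(p ^ e) ->
    (m * p ^ e < n)%N ->
  ('X - (b ^+ (p ^ e))%:P) ^+ m.+1 %| Q.
Proof.
move=> pcharF dvQ lt_mn; set s := (p ^ e)%N in dvQ lt_mn *.
have p_pr := pcharf_prime pcharF.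
have s_gt0 : (0 < s)%N by rewrite expn_gt0 prime_gt0.
have [->|Q0] := eqVneq Q 0; first exact: dvdp0.
have [k [Q1]] := multiplicity_XsubC Q (b ^+ s).
rewrite Q0 /= => nroot eqQ.
have frob : ('X^s - (b ^+ s)%:P = ('X - b%:P) ^+ s :> {poly F}).
  have pcharP : p \in [pchar {poly F}] by rewrite pchar_poly.
  have pn : [pchar {poly F}].-nat s by rewrite pnatX (pnatE _ p_pr) pcharP.
  by rewrite exprDn_pchar // exprNn_pchar // polyC_exp.
have eqQs : Q \Po 'X^s = (Q1 \Po 'X^s) * ('X - b%:P) ^+ (s * k).
  rewrite eqQ comp_polyM rmorphXn /= comp_polyB comp_polyX comp_polyC frob.
  by rewrite -exprM.
have nroot1 : ~~ root (Q1 \Po 'X^s) b.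
  by rewrite /root horner_comp hornerXn; exact: nroot.
move: dvQ; rewrite eqQs -mup_geq; last first.
  rewrite mulf_neq0 ?expf_neq0 ?polyXsubC_eq0 //.
  by apply: contraNneq nroot1 => ->; rewrite root0.
rewrite mupMr // mup_XsubCX eqxx => le_n.
rewrite eqQ dvdp_mull // dvdp_exp2l // -(ltn_pmul2r s_gt0).
by rewrite (leq_trans lt_mn) // mulnC.
Qed.

Lemma deriv_eq0_pchar (F : fieldType) p (P : {poly F}) :
  p \in [pchar F] -> P^`() = 0 -> exists Q, P = Q \Po 'X^p.
Proof.
move=> pcharF dP; have p_gt0 := prime_gt0 (pcharf_prime pcharF).
exists (\poly_(i < size P) P`_(i * p)).
apply/polyP => i; rewrite coef_comp_poly_Xn //; case: ifP => [pi|npi].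
  rewrite coef_poly divnK //; case: ltnP => // le_i.
  by rewrite nth_default // (leq_trans le_i) // leq_div.
case: i npi => [|i npi]; first by rewrite dvdn0.
have /eqP := congr1 (fun R : {poly F} => R`_i) dP.
rewrite coef_deriv coef0 -mulr_natr mulf_eq0 -(dvdn_pcharf pcharF) npi.
by rewrite orbF => /eqP.
Qed.

(** As long as the derivative vanishes, the polynomial is one in X^p; replacing X^p by X divides its
    positive degree by p, so this stops. *)
Lemma inseparable_decomposition (F : fieldType) p (P : {poly F}) :
    p \in [pchar F] -> (1 < size P)%N ->
  exists e Q, P = Q \Po 'X^(p ^ e) /\ Q^`() != 0.
Proof.
move=> pcharF; have p_gt1 := prime_gt1 (pcharf_prime pcharF).
have [n] := ubnP (size P); elim: n P => // n IH P le_n szP.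
have [dP|dP] := eqVneq P^`() 0; last by exists 0%N, P; rewrite expn0 comp_polyXr.
have [P1 eqP1] := deriv_eq0_pchar pcharF dP.
have szP1 : ((size P).-1 = (size P1).-1 * p)%N.
  by rewrite eqP1 size_comp_poly size_polyXn.
have [||e [Q [eqQ dQ]]] := IH P1; [nia|nia|].
exists e.+1, Q; split=> //.
by rewrite eqP1 eqQ -comp_polyA rmorphXn /= comp_polyX -exprM expnS.
Qed.

Lemma exp_pchar_inj (F : fieldType) p e :
  p \in [pchar F] -> injective (fun x : F => x ^+ (p ^ e)).
Proof.
move=> pcharF x y /= eqxy; have p_pr := pcharf_prime pcharF.
have pn : [pchar F].-nat (p ^ e)%N by rewrite pnatX (pnatE _ p_pr) pcharF.
apply/eqP; rewrite -subr_eq0; have /eqP : (x - y) ^+ (p ^ e) = 0.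
  by rewrite exprDn_pchar // exprNn_pchar // eqxy subrr.
by rewrite expf_eq0 => /andP[].
Qed.

(** * The lower bound on the degree of g *)

Lemma lacunary_bound (F : finFieldType) p r (A : {set F}) (g : {poly F}) :
    prime p -> #|F| = (p ^ (2 * r + 1))%N -> (2 * p ^ r < #|A|)%N ->
    (size g <= #|F|)%N ->
    (forall b, b \in A -> ('X - b%:P) ^+ #|A| %| 'X^#|F| - g) ->
  (#|A| ^ 2 < 2 * size g)%N.
Proof.
move=> p_pr oF lt_A le_g dvA; have pcharF := card_finPcharP oF p_pr.
have p_gt0 := prime_gt0 p_pr; set q := #|F| in oF le_g dvA.
have szP : size ('X^q - g) = q.+1.
  by rewrite size_polyDl ?size_polyXn // size_polyN ltnS.
have q_gt0 : (0 < q)%N by rewrite oF expn_gt0 p_gt0.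
have [|e [Q [defP dQ]]] := inseparable_decomposition pcharF (P := 'X^q - g).
  by rewrite szP.
set s := (p ^ e)%N in defP; have s_gt0 : (0 < s)%N by rewrite expn_gt0 p_gt0.
have q_eq : q = ((size Q).-1 * s)%N.
  by rewrite -[LHS]/(q.+1.-1) -szP defP size_comp_poly size_polyXn.
have Q0 : Q != 0 by apply: contraNneq dQ => ->; rewrite deriv0.
have A_gt0 : (0 < #|A|)%N by apply: leq_trans lt_A.
have dvQ m b : (m * s < #|A|)%N -> b \in A -> ('X - (b ^+ s)%:P) ^+ m.+1 %| Q.
  by move=> lt_m /dvA; rewrite defP => /(dvdp_exp_XsubC_comp_pchar pcharF); apply.
have s_inj : {in A &, injective (fun b : F => b ^+ s)}.
  by move=> b c _ _; apply: exp_pchar_inj pcharF _ _.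
(* Q has |A| distinct roots b^s, so |A| s <= q; this forces s <= p^r. *)
have le_e : (e <= r)%N.
  have := card_exp_XsubC_lt_size s_inj (fun b => dvQ 0%N b A_gt0) Q0.
  rewrite muln1 -(ltn_predK (_ : 0 < size Q)%N) ?size_poly_gt0 // ltnS => le_AQ.
  rewrite leqNgt; apply/negP => lt_re.
  (* As p^r p^(r+1) = q, this reads 2 q < q. *)
  have : (2 * p ^ r * p ^ r.+1 < q)%N.
    rewrite q_eq; apply: (@leq_trans (#|A| * p ^ r.+1)).
      by rewrite ltn_pmul2r // expn_gt0 p_gt0.
    by rewrite leq_mul // leq_exp2l // prime_gt1.
  rewrite oF -mulnA -expnD ltnNge => /negP; apply.
  by rewrite (_ : r + r.+1 = 2 * r + 1)%N ?leq_pmull //; lia.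
(* The leading exponent q / s of Q is divisible by p, so it does not survive
   in Q': every monomial of Q' comes from one of g. *)
have szdQ : (size Q^`() * s < size g)%N.
  rewrite ltnNge; apply/negP => le_gs.
  have := dQ; rewrite -lead_coef_eq0 lead_coefE.
  have szdQ_gt0 : (0 < size Q^`())%N by rewrite size_poly_gt0.
  rewrite coef_deriv (ltn_predK szdQ_gt0).
  (* The leading coefficient of Q' is size(Q') times the coefficient of Q at that index, which sits
     at index size(Q') s in X^q - g, beyond the degree of g. *)
  have -> : Q`_(size Q^`()) = ('X^q - g)`_(size Q^`() * s).
    by rewrite defP coef_comp_poly_Xn // dvdn_mull // mulnK.
  rewrite coefB coefXn [g`_ _]nth_default // subr0.
  have [eqq|_] := eqVneq (size Q^`() * s)%N q; last by rewrite mul0rn eqxx.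
  have /eqP-> : (size Q^`())%:R == 0 :> F; last by rewrite eqxx.
  rewrite -(dvdn_pcharf pcharF).
  (* By [le_e] the exponent 2r + 1 - e is positive, so p divides size(Q'). *)
  have -> : size Q^`() = (p ^ (2 * r + 1 - e))%N.
    apply/eqP; rewrite -(eqn_pmul2r s_gt0) eqq oF -expnD subnK //; lia.
  by rewrite dvdn_exp //; lia.
(* The largest m with m s < |A|: each b^s has multiplicity at least m + 1 in Q, hence at least m in
   Q'. *)
pose m := (#|A|.-1 %/ s)%N.
have lt_ms : (m * s < #|A|)%N.
  by rewrite -(ltn_predK A_gt0) ltnS leq_divM.
have lt_Am := card_exp_XsubC_lt_size s_inj
  (fun b bA => dvdp_exp_XsubC_deriv (dvQ m b lt_ms bA)) dQ.
have le_A : (#|A| <= m * s + s)%N.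
  by rewrite -(ltn_predK A_gt0) addnC -mulSn ltn_ceil.
have le_s : (2 * s < #|A|)%N.
  by apply: leq_ltn_trans lt_A; rewrite leq_mul2l leq_exp2l ?prime_gt1.
have : (#|A| * m * s < size g)%N.
  by apply: leq_ltn_trans szdQ; rewrite leq_mul2r (ltnW lt_Am) orbT.
(* Here m s >= |A| - s > |A| / 2. *)
move: le_A le_s; move: #|A| (size g) => a d; clear; nia.
Qed.

(** * Directions and the Redei polynomial *)

Definition directions (F : finFieldType) (A : {set F}) : {set option F} :=
  quotset (diffset A A) (diffset A A).

Lemma mem_directions (F : finFieldType) (A : {set F}) a b c d :
    a \in A -> b \in A -> c \in A -> d \in A ->
  quot (a - b) (c - d) \in directions A.
Proof. by move=> *; apply: imset2_f; apply: imset2_f. Qed.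

Lemma infinity_direction (F : finFieldType) (A : {set F}) :
  (1 < #|A|)%N -> None \in directions A.
Proof.
move=> A_gt1; have [a [b [aA bA ab]]] := card_gt1P A_gt1.
by have := mem_directions aA aA aA aA; rewrite /quot subrr eqxx.
Qed.

(** This keeps the indices k >= |D| away from 1, the only one where X has a nonzero coefficient. *)
Lemma card_directions_gt1 (F : finFieldType) (A : {set F}) :
  (1 < #|A|)%N -> (1 < #|directions A|)%N.
Proof.
move=> A_gt1; apply/card_gt1P; exists None, (Some 0); split=> //.
  exact: infinity_direction.
have [a [b [aA bA ab]]] := card_gt1P A_gt1.
have := mem_directions aA aA aA bA.
by rewrite /quot subrr subr_eq0 (negPf ab) mul0r.
Qed.

(** Infinity is itself a direction, so at most |D| - 1 elements of F are directions. *)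
Lemma card_nondirections (F : finFieldType) (A : {set F}) : (1 < #|A|)%N ->
  (#|F|.+1 - #|directions A| <= #|[set y | Some y \notin directions A]|)%N.
Proof.
move=> A_gt1; set D := directions A; pose D1 := [set y | Some y \in D].
have lt_D : (#|D1| < #|D|)%N.
  rewrite -(card_imset (mem D1) Some_inj); apply: proper_card.
  apply/properP; split.
    by apply/subsetP => _ /imsetP[y yD ->]; rewrite inE in yD.
  by exists None; [exact: infinity_direction | apply/imsetP => -[]].
have -> : [set y | Some y \notin D] = ~: D1 by apply/setP => y; rewrite !inE.
by rewrite -(cardsC D1) leq_subLR -addSn leq_add2r.
Qed.

(** The witness g is S(X, 0). Its bound by |A|^2, the degree of H, later ensures that X^q is the
    leading term of X^q - g. *)
Lemma redei_lacunary (F : finFieldType) (A : {set F}) : (1 < #|A|)%N ->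
  exists g : {poly F},
  [/\ (size g <= #|directions A|)%N, (size g <= #|A| * #|A|)%N
    & forall b, b \in A -> ('X - b%:P) ^+ #|A| %| 'X^#|F| - g].
Proof.
move=> A_gt1; set D := directions A; pose E := setX A A; pose n := (#|A| * #|A|)%N.
have n_gt1 : (1 < n)%N by rewrite /n; nia.
have cardAA : #|E| = n by rewrite cardsX.
pose c (u : F * F) : {poly F} := u.2%:P - u.1 *: 'X.
pose H : {poly {poly F}} := \prod_(u in E) ('X - (c u)%:P).
have size_prodE (R : idomainType) (f : F * F -> R) :
    size (\prod_(u in E) ('X - (f u)%:P)) = n.+1.
  by rewrite -big_enum size_prod_XsubC -cardE cardAA.
have wH : wdeg n H.
  rewrite -cardAA; apply: wdeg_prod => u [|[|k]];
    rewrite coefB coefX coefC /=; last first.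
  - by rewrite subrr size_poly0.
  - by rewrite subr0 size_poly1.
  rewrite sub0r size_polyN /c (leq_trans (size_polyD _ _)) // geq_max size_polyN.
  rewrite (leq_trans (size_polyC_leq1 _)) //.
  by rewrite (leq_trans (size_scale_leq _ _)) ?size_polyX.
have H_monic : H \is monic by rewrite /H -big_enum monic_prod_XsubC.
have [Q [S [eqX szS wS]]] :=
  monic_divXn_wdeg #|F| (ltnW n_gt1) H_monic (size_prodE _ _) wH.
pose ev y := map_poly (horner_eval y) : {poly {poly F}} -> {poly F}.
have evH y : ev y H = \prod_(u in E) ('X - (u.2 - u.1 * y)%:P).
  rewrite /ev rmorph_prod; apply: eq_bigr => u _.
  by rewrite rmorphB /= map_polyX map_polyC /= /horner_eval !hornerE.
have evX y : 'X^#|F| = ev y Q * ev y H + ev y S.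
  by rewrite -rmorphM -rmorphD -eqX /= map_polyXn.
have szev y : (size (ev y S) <= n)%N.
  apply/leq_sizeP => j le_j; rewrite coef_map /= /horner_eval.
  by rewrite nth_default ?horner0 // (leq_trans szS).
have evS y : Some y \notin D -> ev y S = 'X.
  move=> yD; apply/eqP; rewrite -subr_eq0; apply: contraTT isT => nz.
  have : ev y H %| ev y S - 'X.
    have -> : ev y S - 'X = ('X^#|F| - 'X) - ev y Q * ev y H.
      by rewrite (evX y); ring.
    rewrite dvdp_sub ?dvdp_mull // evH.
    rewrite (eq_bigr (fun u => ('X - (u.2 - u.1 * y)%:P) ^+ 1)) //.
    apply: dvdp_prod_XsubC_exp => [[a b] [a' b']|u _]; last first.
      by rewrite expr1 dvdp_XsubCl /root !hornerE expf_card subrr.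
    (* If b - a y = b' - a' y for distinct pairs, then a <> a' and y = (b - b') / (a - a') is a
       direction. *)
    rewrite !in_setX /= => /andP[aA bA] /andP[aA' bA'] eqab.
    have eqy : b - b' = (a - a') * y.
      apply/eqP; rewrite -subr_eq0 -(subrr (b - a * y)) {2}eqab.
      by apply/eqP; ring.
    have [eqa|neqa] := eqVneq a a'.
      by move/eqP: eqy; rewrite eqa subrr mul0r subr_eq0 => /eqP ->.
    case/negP: yD; have := mem_directions bA bA' aA aA'.
    by rewrite /quot subr_eq0 (negPf neqa) eqy mulrAC mulfV ?mul1r ?subr_eq0.
  (* S(X, y) - X has size at most n, too small for a nonzero multiple of H(X, y), whose size is n +
     1. *)
  move=> /(dvdp_leq nz); rewrite evH size_prodE ltnNge; apply: contraNN => _.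
  by rewrite (leq_trans (size_polyD _ _)) // geq_max size_polyN size_polyX szev.
(* The coefficients r_k(Y) - [k = 1] have more roots than their degree. *)
have S0 k : (#|D| <= k)%N -> S`_k = 0.
  move=> le_k; apply/eqP; apply: contraTT isT => nz.
  have := max_poly_roots nz _ (enum_uniq [set y | Some y \notin D]).
  rewrite -cardE ltnNge (leq_trans (wS k)); last first.
    by apply: leq_trans (card_nondirections A_gt1); rewrite leq_sub2l.
  apply; apply/allP => y; rewrite mem_enum inE => /evS /(congr1 (coefp k)) /=.
  rewrite coef_map coefX /= /horner_eval /root => ->.
  by rewrite (gtn_eqF (leq_trans (card_directions_gt1 A_gt1) le_k)).
exists (ev 0 S); split=> // [|b bA].
  by apply/leq_sizeP => j /S0 Sj; rewrite coef_map /= /horner_eval Sj horner0.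
(* At y = 0 the factor of (a, b) is X - b whatever a is, so each b occurs |A| times in H(X, 0). *)
rewrite (evX 0) addrK dvdp_mull // evH.
rewrite (eq_bigl (fun u => (u.1 \in A) && (u.2 \in A))); last first.
  by case=> a b'; rewrite in_setX.
rewrite (eq_bigr (fun u => 'X - u.2%:P)) => [|u _]; last by rewrite mulr0 subr0.
rewrite -(pair_big (mem A) (mem A) (fun _ a => 'X - a%:P)) /=.
by rewrite prodr_const dvdp_exp2r // (bigD1 b) //= dvdp_mulr.
Qed.

Theorem corollary1p8 (R : rcfType) (p r q : nat) (F : finFieldType)
    (A : {set F}) (hp : prime p) (hq : q = (p ^ (2 * r + 1))%N)
    (hF : #|F| = q) (hA1 : (2 * p ^ r < #|A|)%N)
    (hA2 : #|A|%:R < Num.sqrt (q%:R : R)) :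
  #|quotset (diffset A A) (diffset A A)|%:R > (#|A|%:R : R) ^+ 2 / 2.
Proof.
have A_gt1 : (1 < #|A|)%N.
  by apply: leq_ltn_trans hA1; rewrite muln_gt0 expn_gt0 (prime_gt0 hp).
have ltAq : (#|A| * #|A| < #|F|)%N.
  rewrite hF -(ltr_nat R) natrM -expr2.
  by rewrite -[ltRHS]sqr_sqrtr ?ler0n // ltr_pXn2r // nnegrE ?ler0n ?sqrtr_ge0.
have [g [le_gD le_gA dvg]] := redei_lacunary A_gt1.
have lt_A2 : (#|A| ^ 2 < 2 * size g)%N.
  apply: lacunary_bound hp _ hA1 (leq_trans le_gA (ltnW ltAq)) dvg.
  by rewrite hF hq.
rewrite ltr_pdivrMr ?ltr0n // -natrX -natrM ltr_nat mulnC.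
by apply: leq_trans lt_A2 _; rewrite leq_mul2l.
Qed.
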